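(* In the setting described in the context, if the parametrisation $\mathcal P_0=(X,\Theta)$ is partially tight in parameter (PTIP), then $\mathcal P_0$ is uniformly ergodic. Likewise, if $\mathcal P_1=(\tilde X,\Theta)$ is PTIP, then $\mathcal P_1$ is uniformly ergodic.
   Context: Fix an observed value $y\in\mathbb R$. Consider the model $Y=X+Z_1$, $X=\Theta+Z_2$, where $Z_1,Z_2$ are independent real random variables, independent of $\Theta$, whose distributions are symmetric about $0$ and have continuous, bounded, everywhere positive Lebesgue densities $f_1,f_2$; $\Theta$ is given the improper flat (Lebesgue) prior on $\mathbb R$, and the posterior $\mathcal L(X,\Theta\mid Y=y)$ is proper. Write $\tilde X=X-\Theta$. For a parametrisation $\mathcal P=(U,\Theta)$ with $U\in\{X,\tilde X\}$, the Gibbs sampler started at $\Theta_0$ iterates, for $n\ge1$: draw $U_n\sim\mathcal L(U\mid Y=y,\Theta=\Theta_{n-1})$, then $\Theta_n\sim\mathcal L(\Theta\mid Y=y,U=U_n)$. The centred parametrisation is $\mathcal P_0=(X,\Theta)$ and the non-centred one is $\mathcal P_1=(\tilde X,\Theta)$. A parametrisation is called geometrically ergodic if its marginal chain $\{\Theta_n\}$ satisfies $\|\mathcal L(\Theta_n\mid Y=y,\Theta_0)-\mathcal L(\Theta\mid Y=y)\|_{TV}\le M(\Theta_0)r^n$ for all $n$, for some $r<1$ and some function $M$; it is called uniformly ergodic if in addition $M$ can be taken bounded. A parametrisation $(U,\Theta)$ is PTIP (partially tight in parameter) if for every $y$ there is $k>0$ with $\limsup_{|\theta|\to\infty}\mathbf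 P(|U|>k\mid Y=y,\Theta=\theta)<1$. *)

(* Defs.v *)
From HB Require Import structures.
From mathcomp Require Import all_boot all_order all_algebra.
From mathcomp Require Import all_classical all_reals all_analysis.
Set Implicit Arguments. Unset Strict Implicit. Unset Printing Implicit Defensive.
Import Order.TTheory GRing.Theory Num.Theory.
Import numFieldNormedType.Exports.
Local Open Scope classical_set_scope.
Local Open Scope ring_scope.

Section Gibbs.
Variable R : realType.

Definition leb : set R -> \bar R := @lebesgue_measure R.

Definition good_density (f : R -> R) : Prop :=
  [/\ continuous f,
      (exists B : R, forall x, `|f x| <= B),
      (forall x, 0 < f x),
      (forall x, f (- x) = f x)
    & (\int[leb]_x (f x)%:E = 1)%E].

(* An (unnormalised) joint posterior density  p u t  of (U, Theta) given Y = y
   (flat prior on Theta). *)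
Definition jdens := R -> R -> R.

Definition normU (p : jdens) (t : R) : R := fine (\int[leb]_u (p u t)%:E).
Definition condU (p : jdens) (t u : R) : R := p u t / normU p t.

Definition normT (p : jdens) (u : R) : R := fine (\int[leb]_t (p u t)%:E).
Definition condT (p : jdens) (u t : R) : R := p u t / normT p u.

Fixpoint gibbs_law (p : jdens) (n : nat) (t0 : R) (A : set R) : \bar R :=
  match n with
  | O => (\1_A t0)%:E
  | S m => (\int[leb]_u ((condU p t0 u)%:E *
              \int[leb]_t ((condT p u t)%:E * gibbs_law p m t A)))%E
  end.

Definition margT (p : jdens) (t : R) : R := fine (\int[leb]_u (p u t)%:E).
Definition post (p : jdens) (A : set R) : \bar R :=
  ((\int[leb]_(t in A) (margT p t)%:E) *
     (fine (\int[leb]_t (margT p t)%:E))^-1%:E)%E.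

Definition tv (mu nu : set R -> \bar R) : \bar R :=
  ereal_sup [set d | exists A : set R, measurable A /\ d = `| (mu A - nu A)%E |%E ].

Definition uniformly_ergodic (p : jdens) : Prop :=
  exists (M : R -> R) (r : R),
    0 <= r < 1 /\ (exists B : R, forall t, M t <= B) /\
    forall (t0 : R) (n : nat),
      (tv (gibbs_law p n t0) (post p) <= (M t0 * r ^+ n)%:E)%E.

Definition tailU (p : jdens) (k t : R) : \bar R :=
  (\int[leb]_(u in [set u : R | (k < `|u|)%R]) (condU p t u)%:E)%E.

(* PTIP: for every y there is k > 0 with limsup_{|t|->oo} P(|U|>k | y, t) < 1. *)
Definition PTIP (pfam : R -> jdens) : Prop :=
  forall y : R, exists k : R, 0 < k /\
    exists c : R, c < 1 /\ exists T : R,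
      forall t : R, T < `|t| -> (tailU (pfam y) k t <= c%:E)%E.

(* Joint posterior densities (up to normalisation) of the two parametrisations.
   Centred: (X, Theta), density f1(y - x) f2(x - t).
   Non-centred: (Xtilde, Theta), Xtilde = X - Theta, density f1(y - t - u) f2(u). *)
Definition p_centred (f1 f2 : R -> R) (y : R) : jdens :=
  fun x t => f1 (y - x) * f2 (x - t).
Definition p_noncentred (f1 f2 : R -> R) (y : R) : jdens :=
  fun u t => f1 (y - t - u) * f2 u.

Definition proper_posterior (f1 f2 : R -> R) (y : R) : Prop :=
  (\int[leb]_t \int[leb]_x (p_centred f1 f2 y x t)%:E < +oo)%E.

End Gibbs.

(* Main.v *)
Require Import Defs.
From HB Require Import structures.
From mathcomp Require Import all_boot all_order all_algebra.
From mathcomp Require Import all_classical all_reals all_analysis.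
From mathcomp Require Import measurable_realfun lra ring.
Import Order.TTheory GRing.Theory Num.Theory.
Import numFieldNormedType.Exports.
Set Implicit Arguments.
Unset Strict Implicit.
Unset Printing Implicit Defensive.
Local Open Scope classical_set_scope.
Local Open Scope ring_scope.

(** PTIP keeps the probability of [|U| <= k] away from [0] when [|t|] is large;
    for [t] in a bounded set the conditional density of [U] is bounded below on
    [[-k, k]] by compactness. So [P(|U| <= k | t) >= eta > 0] for every [t]. As
    [condT p u] is bounded below by some [c > 0] on [[0, 1]], uniformly in
    [|u| <= k], the whole line is small for the chain (Doeblin): if
    [a <= g <= b], one Gibbs step sends [g] into an interval of length
    [(1 - c * eta) * (b - a)]. The posterior is invariant by Tonelli, so its
    value on a set [A] lies between the bounds of the [n]-step law of [A], which
    are at distance [(1 - c * eta) ^+ n]. *)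

(* [lebesgue_measure] is declared a measure on [measurableTypeR R]; [leb] uses
   the canonical structure of [R], whose display differs, so that the two
   integrals are not convertible. *)
Section leb_measure.
Context (R : realType).

Let leb0 : @leb R set0 = 0%E. Proof. exact: measure0. Qed.

Let leb_ge0 (A : set R) : (0 <= @leb R A)%E. Proof. exact: measure_ge0. Qed.

Let leb_sigma_additive : semi_sigma_additive (@leb R).
Proof. exact: (@measure_semi_sigma_additive _ _ _ (@lebesgue_measure R)). Qed.

HB.instance Definition _ :=
  @isMeasure.Build _ _ R (@leb R) leb0 leb_ge0 leb_sigma_additive.

Let leb_sigma_finite : sigma_finite setT (@leb R).
Proof. exact: (@sigma_finiteT _ _ _ (@lebesgue_measure R)). Qed.

HB.instance Definition _ :=
  @Measure_isSigmaFinite.Build _ _ R (@leb R) leb_sigma_finite.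

End leb_measure.

(** The identity is measurable between the two structures, and [leb] is the pushforward of
    [lebesgue_measure] along it. *)
Lemma integral_lebE (R : realType) (f : R -> \bar R) :
  measurable_fun setT f -> (forall x, (0 <= f x)%E) ->
  (\int[@leb R]_x f x = \int[@lebesgue_measure R]_x f x)%E.
Proof.
move=> mf f0.
have mid : measurable_fun setT (id : measurableTypeR R -> R) by [].
exact: (ge0_integral_pushforward mid (@lebesgue_measure R) measurableT mf (fun y _ => f0 y)).
Qed.

Lemma ge0_integral_translate (R : realType) (G : R -> R) (a : R) :
  continuous G -> (forall x, 0 <= G x) ->
  (\int[@leb R]_x (G (x + a))%:E = \int[@leb R]_x (G x)%:E)%E.
Proof.
move=> cG G0.
have dF : derive1 (fun x : R => x + a) = cst 1.
  apply/funext => x; rewrite derive1E deriveD // derive_id derive_cst addr0 //.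
have mG := continuous_measurable_fun cG.
rewrite !integral_lebE //; last 3 first.
- exact/measurable_EFinP.
- apply/measurable_EFinP; apply: (measurableT_comp mG).
  exact: measurable_funD.
- by move=> x; rewrite lee_fin.
rewrite [RHS](@increasing_ge0_integration_by_substitutionT R (fun x => x + a)) //.
- by apply: eq_integral => x _; rewrite dF /= mulr1.
- by move=> x y xy; rewrite ltrD2r.
- by rewrite dF => x; exact: cvg_cst.
- by rewrite dF; exact: is_cvg_cst.
- by rewrite dF; exact: is_cvg_cst.
- exact: cvg_addrr_Ny.
- exact: cvg_addrr.
Qed.

(** * Means of test functions against a probability density *)

Section mean.
Context d (T : measurableType d) (R : realType).
Context (mu : {measure set T -> \bar R}).
Implicit Types (w h q : T -> R) (D : set T).

Definition prob_density w : Prop :=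
  [/\ measurable_fun setT w, (forall x, 0 <= w x)
    & (\int[mu]_x (w x)%:E = 1)%E].

(** This class of test functions is stable under [h] to [1 - h], so every lower bound on a mean also
    yields an upper bound. *)
Definition unit_fun h : Prop :=
  measurable_fun setT h /\ forall x, 0 <= h x <= 1.

Definition mean w h : R := fine (\int[mu]_x (w x * h x)%:E).

Lemma unit_funC h : unit_fun h -> unit_fun (fun x => 1 - h x).
Proof.
move=> [mh h01]; split; first exact: measurable_funB.
by move=> x; have := h01 x; lra.
Qed.

Lemma meanE w h : prob_density w -> unit_fun h ->
  (\int[mu]_x (w x * h x)%:E = (mean w h)%:E)%E.
Proof.
move=> [mw w0 w1] [mh h01]; rewrite fineK //.
rewrite ge0_fin_numE; last first.
  by apply: integral_ge0 => x _; rewrite lee_fin mulr_ge0 //; case/andP: (h01 x).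
apply: (@le_lt_trans _ _ (\int[mu]_x (w x)%:E)%E); last by rewrite w1 ltry.
apply: ge0_le_integral => //.
- by move=> x _; rewrite lee_fin mulr_ge0 //; case/andP: (h01 x).
- exact/measurable_EFinP/measurable_funM.
- exact/measurable_EFinP.
- by move=> x _; rewrite lee_fin ler_piMr //; case/andP: (h01 x).
Qed.

Lemma mean_ge0 w h : prob_density w -> unit_fun h -> 0 <= mean w h.
Proof.
move=> [_ w0 _] [_ h01]; apply: fine_ge0; apply: integral_ge0 => x _.
by rewrite lee_fin mulr_ge0 //; case/andP: (h01 x).
Qed.

Lemma meanC w h : prob_density w -> unit_fun h ->
  mean w (fun x => 1 - h x) = 1 - mean w h.
Proof.
move=> pw uh; have uh' := unit_funC uh.
apply/eqP; rewrite eq_sym subr_eq; apply/eqP; apply: EFin_inj.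
rewrite EFinD -!meanE //; case: pw => mw w0 w1; case: uh uh' => mh h01 [mh' h01'].
rewrite -ge0_integralD //.
- by rewrite -w1; apply: eq_integral => x _; rewrite -EFinD; congr EFin; ring.
- by move=> x _; rewrite lee_fin mulr_ge0 //; case/andP: (h01' x).
- exact/measurable_EFinP/measurable_funM.
- by move=> x _; rewrite lee_fin mulr_ge0 //; case/andP: (h01 x).
- exact/measurable_EFinP/measurable_funM.
Qed.

Lemma mean_le1 w h : prob_density w -> unit_fun h -> mean w h <= 1.
Proof.
by move=> pw uh; rewrite -subr_ge0 -meanC //; apply: mean_ge0 => //; exact: unit_funC.
Qed.

(** Integrate the pointwise inequality: [w] has mass one, so [w * s] contributes exactly [s], and
    [q] records the gain above this base value. The two lower bounds that follow differ only in the
    choice of [q]. *)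
Lemma mean_gap w h q (s : R) : prob_density w -> unit_fun h ->
  measurable_fun setT q -> (forall x, 0 <= q x) -> 0 <= s ->
  (forall x, w x * s + q x <= w x * h x) ->
  (s%:E + \int[mu]_x (q x)%:E <= (mean w h)%:E)%E.
Proof.
move=> pw uh mq q0 s0 le_wh; rewrite -meanE //.
case: pw uh => mw w0 w1 [mh h01].
have -> : s%:E = (\int[mu]_x (w x * s)%:E)%E.
  under eq_integral do rewrite EFinM.
  rewrite ge0_integralZr ?w1 ?mul1e ?lee_fin //; first exact/measurable_EFinP.
  by move=> x _; rewrite lee_fin.
rewrite -ge0_integralD //.
- apply: ge0_le_integral => //.
  + by move=> x _; rewrite -EFinD lee_fin addr_ge0 ?mulr_ge0.
  + by apply/measurable_EFinP/measurable_funD => //; exact: measurable_funM.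
  + exact/measurable_EFinP/measurable_funM.
  + by move=> x _; rewrite -EFinD lee_fin.
- by move=> x _; rewrite lee_fin mulr_ge0.
- exact/measurable_EFinP/measurable_funM.
- by move=> x _; rewrite lee_fin.
- exact/measurable_EFinP.
Qed.

(** The gain [e] is earned on an event of probability at least [eta]. This form serves the update of
    [U], where [D] is hit often enough. *)
Lemma mean_ge_set w h D (s e eta : R) : prob_density w -> unit_fun h ->
  measurable D -> 0 <= s -> 0 <= e -> (forall x, s <= h x) ->
  (forall x, D x -> s + e <= h x) ->
  (eta%:E <= \int[mu]_(x in D) (w x)%:E)%E -> s + e * eta <= mean w h.
Proof.
move=> pw uh mD s0 e0 sh seh le_eta; case: (pw) => mw w0 w1.
have mID : measurable_fun setT (\1_D : T -> R) by exact: measurable_indic.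
rewrite -lee_fin.
apply: le_trans (mean_gap pw uh (q := fun x => e * (w x * \1_D x)) _ _ s0 _).
- rewrite EFinD leeD2l //; under eq_integral do rewrite EFinM.
  rewrite ge0_integralZl_EFin //.
  + rewrite EFinM lee_wpmul2l ?lee_fin //.
    rewrite integral_mkcond epatch_indic in le_eta.
    by under eq_integral do rewrite EFinM.
  + by move=> x _; rewrite lee_fin mulr_ge0.
  + exact/measurable_EFinP/measurable_funM.
- by apply: measurable_funM => //; exact: measurable_funM.
- by move=> x; rewrite !mulr_ge0.
- move=> x; rewrite indicE.
  have [/set_mem Dx|nDx] := boolP (x \in D) => /=.
    by have := seh _ Dx; have := w0 x; nra.
  by have := sh x; have := w0 x; nra.
Qed.

(** On [D] the density dominates [c] times Lebesgue measure, so the nonnegative function [h - s] has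
    mean at least [c] times its integral over [D]. This form serves the update of [Theta]. *)
Lemma mean_ge_minorized w h D (s c : R) : prob_density w -> unit_fun h ->
  measurable D -> 0 <= s -> 0 <= c -> (forall x, s <= h x) ->
  (forall x, D x -> c <= w x) ->
  (s%:E + c%:E * \int[mu]_(x in D) (h x - s)%:E <= (mean w h)%:E)%E.
Proof.
move=> pw uh mD s0 c0 sh cw; case: (pw) => mw w0 w1; case: (uh) => mh _.
have mID : measurable_fun setT (\1_D : T -> R) by exact: measurable_indic.
have mhs : measurable_fun setT (fun x => h x - s) by exact: measurable_funB.
apply: le_trans (mean_gap pw uh (q := fun x => c * ((h x - s) * \1_D x)) _ _ s0 _).
- rewrite leeD2l //; under [leRHS]eq_integral do rewrite EFinM.
  rewrite ge0_integralZl_EFin //.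
  + rewrite integral_mkcond epatch_indic.
    by under [in leRHS]eq_integral do rewrite EFinM.
  + by move=> x _; rewrite lee_fin mulr_ge0 // subr_ge0.
  + exact/measurable_EFinP/measurable_funM.
- by apply: measurable_funM => //; exact: measurable_funM.
- by move=> x; rewrite !mulr_ge0 // subr_ge0.
- move=> x; rewrite indicE.
  have [/set_mem Dx|nDx] := boolP (x \in D) => /=.
    by have := cw _ Dx; have := sh x; nra.
  by have := sh x; have := w0 x; nra.
Qed.

Lemma mean_ge w h (s : R) : prob_density w -> unit_fun h ->
  0 <= s -> (forall x, s <= h x) -> s <= mean w h.
Proof.
move=> pw uh s0 sh; rewrite -[leLHS]addr0 -(mul0r 0).
by apply: (mean_ge_set (D := set0)) => //; rewrite integral_set0.
Qed.

End mean.

(** * The Gibbs kernel of a regular joint density, and its invariant measure *)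

Section gibbs_kernel.
Context (R : realType).
Let mu := @leb R.

Implicit Types (p : jdens R) (g h : R -> R) (B : R).

Lemma integral_ge_cst (f : R -> R) (c k : R) : 0 <= k -> 0 <= c ->
  measurable_fun setT f -> (forall x, 0 <= f x) ->
  (forall x, `|x| <= k -> c <= f x) ->
  ((c * (k *+ 2))%:E <= \int[mu]_(x in `[(- k)%R, k]) (f x)%:E)%E.
Proof.
move=> k0 c0 mf f0 cf.
have muk : mu `[- k, k] = (k *+ 2)%:E.
  rewrite [LHS](lebesgue_measure_itv `[- k, k]) /= lte_fin.
  have [kk|kk] := ltP (- k) k; first by rewrite -EFinB; congr EFin; ring.
  by have -> : k = 0 by [lra]; rewrite mul0rn.
have -> : (c * (k *+ 2))%:E = (\int[mu]_(x in `[(- k)%R, k]) cst c%:E x)%E.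
  by rewrite integral_cst // EFinM; congr (_ * _)%E; exact: esym muk.
apply: ge0_le_integral => //.
- by apply/measurable_EFinP; exact: measurable_funTS.
- by move=> x /=; rewrite in_itv /= -ler_norml lee_fin; exact: cf.
Qed.

(** Gathers all that the ergodicity argument takes from the model, so that both parametrisations are
    treated at once. One constant [B] bounds both partial integrals, which makes the notion stable
    under exchange of the variables. *)
Record regular p B : Prop := Regular {
  regular_gt0 : forall u t, 0 < p u t;
  regular_meas : measurable_fun setT (fun z : R * R => p z.1 z.2);
  regular_lb : forall K, exists2 d : R, 0 < d &
    forall u t, `|u| <= K -> `|t| <= K -> d <= p u t;
  regular_intU : forall t, (\int[mu]_u (p u t)%:E <= B%:E)%E;
  regular_intT : forall u, (\int[mu]_t (p u t)%:E <= B%:E)%E;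
  regular_total : (\int[mu]_t \int[mu]_u (p u t)%:E < +oo)%E }.

(* Exchanging the two variables turns [condT p] into [condU (transp p)] and
   [normT p] into [normU (transp p)], definitionally. *)
Definition transp p : jdens R := fun t u => p u t.

(** The transition kernel acting on functions: the expectation of [g] at the next parameter, given
    the current one. *)
Definition gibbs_step p g : R -> R :=
  fun t => mean mu (condU p t) (fun u => mean mu (condT p u) g).

Lemma regular_measE p B : regular p B ->
  measurable_fun setT (fun z : R * R => (p z.1 z.2)%:E).
Proof. by move=> rp; apply/measurable_EFinP; exact: regular_meas rp. Qed.

(** The order of the double integral is reversed by Tonelli; the other fields are symmetric or
    exchanged in pairs. Facts about [condU] thereby apply to [condT]. *)
Lemma regular_transp p B : regular p B -> regular (transp p) B.
Proof.
move=> rp; have [p0 mp lb iU iT tot] := rp; split => //.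
- by move=> u t; exact: p0.
- exact: (measurableT_comp mp (@measurable_swap _ _ _ _)).
- move=> K; have [d d0 hd] := lb K; exists d => // u t ? ?; exact: hd.
- have := fubini_tonelli (m1 := mu) (m2 := mu) _ (regular_measE rp).
  by rewrite /transp => /= -> // z; rewrite lee_fin ltW.
Qed.

Section regular_density.
Variables (p : jdens R) (B : R).
Hypothesis rp : regular p B.

Let p0 u t : 0 <= p u t. Proof. by rewrite ltW // (regular_gt0 rp). Qed.

Lemma regular_measU t : measurable_fun setT (fun u => p u t).
Proof.
apply: (measurableT_comp (regular_meas rp) (g := fun u => (u, t))).
exact: pair2_measurable.
Qed.

Lemma normUE t : (\int[mu]_u (p u t)%:E = (normU p t)%:E)%E.
Proof.
rewrite /normU fineK // ge0_fin_numE.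
  by rewrite (le_lt_trans (regular_intU rp t)) // ltry.
by apply: integral_ge0 => u _; rewrite lee_fin.
Qed.

Lemma normU_le t : normU p t <= B.
Proof. by rewrite -lee_fin -normUE (regular_intU rp). Qed.

Lemma normU_ge (d k t : R) : 0 <= d -> 0 <= k ->
  (forall u, `|u| <= k -> d <= p u t) -> d * (k *+ 2) <= normU p t.
Proof.
move=> d0 k0 dp; rewrite -lee_fin -normUE.
apply: le_trans (integral_ge_cst k0 d0 (regular_measU t) (p0^~ t) dp) _.
apply: ge0_subset_integral => //.
- by apply/measurable_EFinP; exact: regular_measU.
- by move=> u _; rewrite lee_fin.
Qed.

Lemma normU_gt0 t : 0 < normU p t.
Proof.
(* This square contains both the integration range [[-1, 1]] for [u] and the given [t]. *)
have [d d0 hd] := regular_lb rp (Num.max 1 `|t|).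
apply: lt_le_trans (@normU_ge d 1 t (ltW d0) ler01 _); first by rewrite mulr_gt0.
by move=> u u1; apply: hd; rewrite le_max ?u1 // lexx orbT.
Qed.

Lemma measurable_normU : measurable_fun setT (normU p).
Proof.
apply: measurableT_comp; first exact: fine_measurable.
have := measurable_fun_fubini_tonelli_G (m1 := mu) _ (regular_measE rp).
by apply => z; rewrite lee_fin.
Qed.

Lemma condU_density t : prob_density mu (condU p t).
Proof.
split.
- by rewrite /condU; apply: measurable_funM => //; exact: regular_measU.
- by move=> u; rewrite /condU divr_ge0 // ltW // normU_gt0.
- rewrite /condU; under eq_integral do rewrite EFinM.
  rewrite ge0_integralZr ?normUE //.
  + by rewrite -EFinM mulfV // gt_eqF // normU_gt0.
  + by apply/measurable_EFinP; exact: regular_measU.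
  + by move=> u _; rewrite lee_fin.
  + by rewrite lee_fin invr_ge0 ltW // normU_gt0.
Qed.

Lemma normU_mean h t : unit_fun h ->
  ((normU p t * mean mu (condU p t) h)%:E = \int[mu]_u (p u t * h u)%:E)%E.
Proof.
move=> uh; have [mh h01] := uh.
rewrite EFinM -(meanE (condU_density t)) // -ge0_integralZl_EFin //.
- apply: eq_integral => u _; rewrite -EFinM /condU; congr EFin.
  by field; rewrite gt_eqF // normU_gt0.
- move=> u _; rewrite lee_fin mulr_ge0 //; last by case/andP: (h01 u).
  by case: (condU_density t).
- by apply/measurable_EFinP/measurable_funM => //; case: (condU_density t).
- by rewrite ltW // normU_gt0.
Qed.

Lemma measurable_joint_mul h : measurable_fun setT h ->
  measurable_fun setT (fun z : R * R => (p z.1 z.2 * h z.1)%:E).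
Proof.
move=> mh; apply/measurable_EFinP/measurable_funM; first exact: regular_meas rp.
exact: measurableT_comp mh measurable_fst.
Qed.

Lemma condU_unit_fun h : unit_fun h ->
  unit_fun (fun t => mean mu (condU p t) h).
Proof.
move=> uh; have [mh h01] := uh; split; last first.
  move=> t; rewrite mean_ge0 ?mean_le1 //; exact: condU_density.
(* A quotient of two partial integrals, each measurable by Tonelli. The inverse is written as a
   power to use [measurable_powR]; the two agree as [normU] is positive. *)
have -> : (fun t => mean mu (condU p t) h) =
    (fun t => fine (\int[mu]_u (p u t * h u)%:E) * (normU p t) `^ (-1)).
  apply/funext => t; rewrite -normU_mean // powR_inv1 ?ltW ?normU_gt0 //=.
  by field; rewrite gt_eqF // normU_gt0.
apply: measurable_funM.
  apply: measurableT_comp; first exact: fine_measurable.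
  have := measurable_fun_fubini_tonelli_G (m1 := mu) _ (measurable_joint_mul mh).
  by apply => z; rewrite lee_fin mulr_ge0 //; case/andP: (h01 z.1).
exact: measurableT_comp (measurable_powR _) measurable_normU.
Qed.

End regular_density.

(** The tower property: by Tonelli, both sides are the double integral of [p u t * h u]. *)
Lemma integral_normU_mean p B h : regular p B -> unit_fun h ->
  (\int[mu]_t (normU p t * mean mu (condU p t) h)%:E =
   \int[mu]_u (normU (transp p) u * h u)%:E)%E.
Proof.
move=> rp uh; have [mh h01] := uh.
under eq_integral do rewrite (normU_mean rp) //.
have := fubini_tonelli (m1 := mu) (m2 := mu) _ (measurable_joint_mul rp mh).
move=> /= <-; last first.
  move=> z; rewrite lee_fin mulr_ge0 //; last by case/andP: (h01 z.1).
  by rewrite ltW // (regular_gt0 rp).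
apply: eq_integral => u _; under eq_integral do rewrite EFinM.
have rp' := regular_transp rp.
rewrite ge0_integralZr //.
- by rewrite (normUE rp') EFinM.
- by apply/measurable_EFinP; exact: (regular_measU rp').
- by move=> t _; rewrite lee_fin ltW // (regular_gt0 rp).
- by rewrite lee_fin; case/andP: (h01 u).
Qed.

Lemma gibbs_step_unit_fun p B g : regular p B -> unit_fun g ->
  unit_fun (gibbs_step p g).
Proof.
move=> rp ug; apply: (condU_unit_fun rp).
exact: (condU_unit_fun (regular_transp rp)).
Qed.

Lemma gibbs_stepC p B g : regular p B -> unit_fun g ->
  gibbs_step p (fun t => 1 - g t) = (fun t => 1 - gibbs_step p g t).
Proof.
move=> rp ug; apply/funext => t; rewrite /gibbs_step.
have rp' := regular_transp rp.
rewrite -(meanC (condU_density rp t)); last exact: (condU_unit_fun rp').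
congr mean; apply/funext => u.
by rewrite (meanC (condU_density rp' u)).
Qed.

(** The tower property is used twice: from the marginal of [Theta] to that of [U], then back. *)
Lemma gibbs_step_invariant p B g : regular p B -> unit_fun g ->
  (\int[mu]_t (normU p t * gibbs_step p g t)%:E =
   \int[mu]_t (normU p t * g t)%:E)%E.
Proof.
move=> rp ug; have rp' := regular_transp rp.
rewrite (integral_normU_mean rp); last exact: (condU_unit_fun rp').
exact: (integral_normU_mean rp').
Qed.

Lemma unit_fun_indic (A : set R) : measurable A -> unit_fun (\1_A : R -> R).
Proof.
move=> mA; split; first exact: measurable_indic.
by move=> x; rewrite indicE; case: (_ \in _) => /=; rewrite ?lexx ?ler01.
Qed.

Lemma iter_gibbs_unit_fun p B g n : regular p B -> unit_fun g ->
  unit_fun (iter n (gibbs_step p) g).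
Proof.
by move=> rp ug; elim: n => // n IH /=; exact: (gibbs_step_unit_fun rp).
Qed.

(** [gibbs_law] conditions on the first sweep, which is the outermost application in [iter]. *)
Lemma gibbs_lawE p B n t (A : set R) : regular p B -> measurable A ->
  (gibbs_law p n t A = (iter n (gibbs_step p) \1_A t)%:E)%E.
Proof.
move=> rp mA; have rp' := regular_transp rp; elim: n t => // n IH t /=.
have uA := iter_gibbs_unit_fun n rp (unit_fun_indic mA).
rewrite -(meanE (condU_density rp t)); last exact: (condU_unit_fun rp').
apply: eq_integral => u _; rewrite [RHS]EFinM; congr (_ * _)%E.
apply: etrans (meanE (condU_density rp' u) uA).
by apply: eq_integral => s _; rewrite IH EFinM.
Qed.

End gibbs_kernel.

(** * Doeblin contraction of the range of a test function *)

Section doeblin.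
Context (R : realType).
Let mu := @leb R.
Variables (p : jdens R) (B : R) (D E : set R) (eta c : R).
Hypotheses (rp : regular p B) (mD : measurable D) (mE : measurable E).
Hypotheses (muE : mu E = 1%E) (eta0 : 0 < eta) (c0 : 0 < c).
Hypothesis condU_D : forall t, (eta%:E <= \int[mu]_(u in D) (condU p t u)%:E)%E.
Hypothesis condT_E : forall u t, D u -> E t -> c <= condT p u t.

Let integral_cstE (r : \bar R) : (\int[mu]_(x in E) cst r x = r)%E.
Proof. by rewrite integral_cst // -[RHS]mule1; congr (_ * _)%E; exact: muE. Qed.

(** As [E] has measure one, this is the mean of [g - s] under the uniform law on [E], the minorising
    law. *)
Let excess (g : R -> R) (s : R) : R := fine (\int[mu]_(x in E) (g x - s)%:E).

Let excessE (g : R -> R) (s : R) : unit_fun g -> 0 <= s -> (forall x, s <= g x) ->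
  (\int[mu]_(x in E) (g x - s)%:E = (excess g s)%:E)%E.
Proof.
move=> [mg g01] s0 sg; rewrite /excess fineK // ge0_fin_numE; last first.
  by apply: integral_ge0 => x _; rewrite lee_fin subr_ge0.
apply: (@le_lt_trans _ _ (\int[mu]_(x in E) cst 1%E x)%E).
  apply: ge0_le_integral => //.
  - by move=> x _; rewrite lee_fin subr_ge0.
  - by apply/measurable_EFinP/measurable_funTS; exact: measurable_funB.
  - by move=> x _; rewrite lee_fin; have := g01 x; lra.
by rewrite integral_cstE ltry.
Qed.

Let excess_ge0 (g : R -> R) (s : R) : (forall x, s <= g x) -> 0 <= excess g s.
Proof.
move=> sg; apply: fine_ge0; apply: integral_ge0 => x _.
by rewrite lee_fin subr_ge0.
Qed.

(** The update of [Theta] gains [c * excess g s] over [s] when [u] is in [D], and the update of [U]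
    lands in [D] with probability at least [eta]. *)
Let gibbs_step_ge (g : R -> R) (s t : R) : unit_fun g -> 0 <= s ->
  (forall x, s <= g x) -> s + c * excess g s * eta <= gibbs_step p g t.
Proof.
move=> ug s0 sg; have rp' := regular_transp rp.
have ce0 : 0 <= c * excess g s by apply: mulr_ge0; [exact: ltW | exact: excess_ge0].
apply: (mean_ge_set (condU_density rp t) (D := D)) => //.
- exact: (condU_unit_fun rp').
(* For arbitrary [u] only the trivial minorisation, with constant [0], is available. *)
- move=> u; rewrite -[leLHS]addr0 -(mul0r (excess g s)).
  rewrite -lee_fin EFinD EFinM -excessE //.
  apply: (mean_ge_minorized (condU_density rp' u)) => //.
  by move=> x _; case: (condU_density rp' u).
- move=> u Du; rewrite -lee_fin EFinD EFinM -excessE //.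
  apply: (mean_ge_minorized (condU_density rp' u)) => //; first exact: ltW.
  by move=> x Ex; exact: condT_E.
Qed.

(* The upper bound is the lower bound applied to [1 - g]. *)
Lemma gibbs_step_contracts (g : R -> R) (a b : R) : unit_fun g ->
  0 <= a -> b <= 1 -> (forall x, a <= g x <= b) ->
  exists a' b', [/\ 0 <= a', b' <= 1, b' - a' = (1 - c * eta) * (b - a)
    & forall t, a' <= gibbs_step p g t <= b'].
Proof.
move=> ug a0 b1 ab.
have ag x : a <= g x by case/andP: (ab x).
have gb x : 1 - b <= 1 - g x by case/andP: (ab x) => _; lra.
have ug' := unit_funC ug; have b10 : 0 <= 1 - b by lra.
pose m := excess g a; pose m' := excess (fun x => 1 - g x) (1 - b).
have m0 : 0 <= m by exact: excess_ge0.
have m0' : 0 <= m' by exact: excess_ge0.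
(* The two integrands add up to the constant [b - a], so the total gain at both ends does not depend
   on [g]. *)
have mm' : m + m' = b - a.
  apply: EFin_inj; rewrite EFinD -!excessE // -ge0_integralD //.
  - under eq_integral do rewrite -EFinD.
    transitivity (\int[mu]_(x in E) cst (b - a)%:E x)%E.
      by apply: eq_integral => x _ /=; congr EFin; ring.
    by rewrite integral_cstE.
  - by move=> x _; rewrite lee_fin subr_ge0.
  - by apply/measurable_EFinP/measurable_funTS; apply: measurable_funB => //; case: ug.
  - by move=> x _; rewrite lee_fin subr_ge0.
  - by apply/measurable_EFinP/measurable_funTS; apply: measurable_funB => //; case: ug'.
have ceta0 : 0 <= c * eta by rewrite mulr_ge0 // ltW.
exists (a + c * m * eta), (b - c * m' * eta); split.
- by rewrite addr_ge0 // !mulr_ge0 // ltW.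
- by have : 0 <= c * m' * eta; [rewrite !mulr_ge0 // ltW | lra].
- by rewrite -mm'; have -> : b = a + m + m' by [rewrite -addrA mm'; ring]; ring.
- move=> t; apply/andP; split; first exact: gibbs_step_ge.
  have := gibbs_step_ge t ug' b10 gb.
  by rewrite (gibbs_stepC rp) // -/m'; lra.
Qed.

(** The lower bound for one step, applied to the constant function [1], gives [c * eta <= 1]. *)
Lemma contraction_rate : 0 <= 1 - c * eta < 1.
Proof.
have u1 : unit_fun (fun _ : R => 1 : R).
  by split=> [|x]; [exact: measurable_cst | rewrite ler01 lexx].
have := gibbs_step_ge 0 u1 (lexx 0) (fun=> ler01).
have -> : excess (fun=> 1) 0 = 1.
  rewrite /excess subr0 (_ : \int[mu]_(x in E) _ = \int[mu]_(x in E) cst 1 x)%E //.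
  by rewrite integral_cstE.
rewrite add0r mulr1 => le1.
have := mean_le1 (condU_density rp 0) (condU_unit_fun (regular_transp rp) u1).
have : 0 < c * eta by rewrite mulr_gt0.
rewrite /gibbs_step in le1; rewrite /condT in le1 *; move: le1; lra.
Qed.

Lemma iter_gibbs_contracts (g : R -> R) n : unit_fun g ->
  exists a b, [/\ 0 <= a, b <= 1, b - a = (1 - c * eta) ^+ n
    & forall t, a <= iter n (gibbs_step p) g t <= b].
Proof.
move=> ug; elim: n => [|n [a [b [a0 b1 ba ab]]]].
  by exists 0, 1; split => //; [rewrite subr0 expr0 | case: ug].
have [a' [b' [? ? e ?]]] := gibbs_step_contracts (iter_gibbs_unit_fun n rp ug) a0 b1 ab.
by exists a', b'; split => //; rewrite e ba exprS.
Qed.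

End doeblin.

(** * The posterior as a probability density, stationary for the sampler *)

Section posterior.
Context (R : realType).
Let mu := @leb R.
Variables (p : jdens R) (B : R).
Hypothesis rp : regular p B.

Let Z : R := fine (\int[mu]_t (normU p t)%:E).

Let ZE : (\int[mu]_t (normU p t)%:E = Z%:E)%E.
Proof.
rewrite /Z fineK // ge0_fin_numE.
  have := regular_total rp.
  by under eq_integral do rewrite (normUE rp).
by apply: integral_ge0 => t _; rewrite lee_fin ltW // (normU_gt0 rp).
Qed.

Let mnormU : measurable_fun setT (EFin \o normU p).
Proof. by apply/measurable_EFinP; exact: (measurable_normU rp). Qed.

Let Z_gt0 : 0 < Z.
Proof.
have [d d0 hd] := regular_lb rp 1.
(* The square [[-1, 1]^2] alone carries this mass, since the joint density is at least [d] there. *)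
rewrite -lte_fin -ZE; apply: (@lt_le_trans _ _ (d * (1 *+ 2) * (1 *+ 2))%:E).
  by rewrite lte_fin !mulr_gt0.
apply: le_trans (integral_ge_cst (f := normU p) ler01 _ _ _ _) _.
- by rewrite mulr_ge0 // ltW.
- exact: (measurable_normU rp).
- by move=> t; rewrite ltW // (normU_gt0 rp).
- move=> t t1; apply: (normU_ge rp) => //; first exact: ltW.
  by move=> u u1; exact: hd.
apply: ge0_subset_integral => //.
by move=> t _; rewrite lee_fin ltW // (normU_gt0 rp).
Qed.

Definition post_density (t : R) : R := normU p t / Z.

Let integral_post (h : R -> R) : measurable_fun setT h -> (forall t, 0 <= h t) ->
  (\int[mu]_t (post_density t * h t)%:E =
   \int[mu]_t (normU p t * h t)%:E * (Z^-1)%:E)%E.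
Proof.
move=> mh h0; rewrite -ge0_integralZr //.
- by apply: eq_integral => t _; rewrite -EFinM /post_density mulrAC.
- by apply/measurable_EFinP/measurable_funM => //; exact: (measurable_normU rp).
- by move=> t _; rewrite lee_fin mulr_ge0 // ltW // (normU_gt0 rp).
- by rewrite lee_fin invr_ge0 ltW.
Qed.

Lemma post_density_prob : prob_density mu post_density.
Proof.
split.
- by apply: measurable_funM => //; exact: (measurable_normU rp).
- by move=> t; rewrite divr_ge0 ?ltW // (normU_gt0 rp).
- transitivity (\int[mu]_t (post_density t * 1)%:E)%E.
    by apply: eq_integral => t _; rewrite mulr1.
  rewrite (@integral_post (cst 1)) //; under eq_integral do rewrite mulr1.
  by rewrite ZE -EFinM mulfV // gt_eqF.
Qed.

Lemma postE (A : set R) : measurable A ->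
  post p A = (mean mu post_density \1_A)%:E.
Proof.
move=> mA; have uA := unit_fun_indic mA.
have [mIA IA01] := uA; have IA0 t : 0 <= (\1_A t : R) by case/andP: (IA01 t).
rewrite -(meanE post_density_prob) // integral_post //.
rewrite /post /margT -/mu; congr (_ * _)%E.
rewrite integral_mkcond epatch_indic.
by apply: eq_integral => t _; rewrite EFinM.
Qed.

Lemma mean_post_gibbs (g : R -> R) : unit_fun g ->
  mean mu post_density (gibbs_step p g) = mean mu post_density g.
Proof.
move=> ug; have [mg g01] := ug; have [mk k01] := gibbs_step_unit_fun rp ug.
rewrite /mean !integral_post //.
- by rewrite (gibbs_step_invariant rp).
- by move=> t; case/andP: (g01 t).
- by move=> t; case/andP: (k01 t).
Qed.

Lemma mean_post_iter_gibbs (g : R -> R) n : unit_fun g ->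
  mean mu post_density (iter n (gibbs_step p) g) = mean mu post_density g.
Proof.
move=> ug; elim: n => //= n IH.
by rewrite mean_post_gibbs //; exact: (iter_gibbs_unit_fun _ rp).
Qed.

End posterior.

(** * From the tail bound to uniform ergodicity, for any regular density *)

Lemma regular_ergodic (R : realType) (p : jdens R) (B k c T : R) :
  regular p B -> 0 < k -> c < 1 ->
  (forall t, T < `|t| -> (tailU p k t <= c%:E)%E) -> uniformly_ergodic p.
Proof.
move=> rp k0 c1 tail_le; have rp' := regular_transp rp.
have B0 : 0 < B by apply: lt_le_trans (normU_le rp 0); exact: (normU_gt0 rp).
(* [d] is for [u] in [D] and the bounded parameters [|t| <= T]; [d'] is for [u] in [D] and [t] in
   [E]. *)
have [d d0 hd] := regular_lb rp (Num.max k T).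
have [d' d0' hd'] := regular_lb rp (Num.max k 1).
pose D : set R := `[- k, k]%classic; pose E : set R := `[0, 1]%classic.
have DE u : D u <-> `|u| <= k by rewrite /D /= in_itv /= ler_norml.
(* The tail bound gives [1 - c] for [|t| > T]. For [|t| <= T], the density [condU] is at least
   [d / B] on [D], of length [2k], because [normU] is at most [B]. *)
pose eta := Num.min (1 - c) (d / B * (k *+ 2)).
have eta0 : 0 < eta.
  by rewrite lt_min subr_gt0 c1 /= mulr_gt0 ?divr_gt0 // pmulrn_lgt0.
have mD : measurable D by exact: measurable_itv.
have mE : measurable E by exact: measurable_itv.
have muE : leb E = 1%E.
  by rewrite [LHS](lebesgue_measure_itv `[0, 1]) /= lte_fin ltr01 oppr0 adde0.
have condU_D t : (eta%:E <= \int[@leb R]_(u in D) (condU p t u)%:E)%E.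
  have [mw w0 w1] := condU_density rp t.
  have [tT|Tt] := leP `|t| T.
    apply: (@le_trans _ _ (d / B * (k *+ 2))%:E).
      by rewrite lee_fin ge_min lexx orbT.
    apply: integral_ge_cst => //; [exact: ltW | by rewrite ltW // divr_gt0 |].
    move=> u uk; rewrite /condU ler_pM ?invr_ge0 ?(ltW d0) ?(ltW B0) //.
      by apply: hd; rewrite le_max ?uk ?tT ?orbT.
    by rewrite lef_pV2 ?posrE ?(normU_gt0 rp) ?(normU_le rp).
  apply: (@le_trans _ _ (1 - c)%:E); first by rewrite lee_fin ge_min lexx.
  (* Split the total mass one over [D] and its complement, which is the tail event. *)
  rewrite EFinB leeBlDr // -w1 -(setUv D) ge0_integral_setU //.
  - rewrite leeD2l //; apply: le_trans (tail_le _ Tt).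
    rewrite /tailU (_ : ~` D = [set u | k < `|u|]) //.
    apply/seteqP; split=> u /= => [nD|ku /DE]; last by rewrite leNgt ku.
    by rewrite ltNge; apply/negP => /DE.
  - exact: measurableC.
  - by apply/measurable_EFinP; exact: measurable_funTS.
  - by move=> u _; rewrite lee_fin.
  - by rewrite disj_set2E setICr.
have condT_E u t : D u -> E t -> d' / B <= condT p u t.
  rewrite DE /E /= in_itv /= => uk /andP[t0 t1].
  rewrite [condT p u t]/(condU (transp p) u t) /condU.
  rewrite ler_pM ?invr_ge0 ?(ltW d0') ?(ltW B0) //.
    by apply: hd'; rewrite le_max ?uk // ger0_norm ?t1 ?orbT.
  by rewrite lef_pV2 ?posrE ?(normU_gt0 rp') ?(normU_le rp').
have cc0 : 0 < d' / B by rewrite divr_gt0.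
(* The prefactor is [1], the length of the initial range [[0, 1]] of an indicator. *)
exists (fun=> 1), (1 - d' / B * eta); split.
  exact: (contraction_rate rp mD mE muE eta0 cc0 condU_D condT_E).
split; first by exists 1.
move=> t0 n; rewrite mul1r; apply: ge_ereal_sup => _ [A [mA ->]].
rewrite (gibbs_lawE n t0 rp mA) (postE rp mA).
have uA := unit_fun_indic mA; have un := iter_gibbs_unit_fun n rp uA.
have [a [b [a0 b1 <- ab]]] :=
  iter_gibbs_contracts rp mD mE muE eta0 cc0 condU_D condT_E n uA.
(* By stationarity the posterior mass of [A] is the posterior mean of the [n]-step probabilities, so
   it lies in the same interval [[a, b]] as each of them. *)
rewrite -(mean_post_iter_gibbs rp n uA).
set g := iter _ _ _ in un ab *; have pp := post_density_prob rp.
have am : a <= mean (@leb R) (post_density p) g.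
  by apply: (mean_ge pp un a0) => t; case/andP: (ab t).
have mb : mean (@leb R) (post_density p) g <= b.
  have := mean_ge pp (unit_funC un) (s := 1 - b); rewrite (meanC pp un).
  move=> h; suff: 1 - b <= 1 - mean (@leb R) (post_density p) g by lra.
  by apply: h => [|t]; [lra | case/andP: (ab t) => _; lra].
rewrite -EFinB /= lee_fin ler_norml; case/andP: (ab t0); lra.
Qed.

(** * Regularity of the two parametrisations *)

Lemma continuous_gt0_bounded_below (R : realType) (f : R -> R) (K : R) :
  continuous f -> (forall x, 0 < f x) ->
  exists2 d, 0 < d & forall x, `|x| <= K -> d <= f x.
Proof.
(* With [|K|] the interval is nonempty even for negative [K], as the extreme value theorem
   requires. *)
move=> cf f0; have KK : - `|K| <= `|K| by rewrite ge0_cp.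
have [c _ hc] := EVT_min KK (continuous_subspaceT cf).
exists (f c) => // x xK; apply: hc; rewrite in_itv /= -ler_norml.
exact: le_trans xK (ler_norm K).
Qed.

Section good_density.
Context (R : realType).
Implicit Types f g : R -> R.

Lemma good_density_continuous f : good_density f -> continuous f.
Proof. by case. Qed.

Lemma good_density_gt0 f x : good_density f -> 0 < f x.
Proof. by case. Qed.

Lemma good_densityN f x : good_density f -> f (- x) = f x.
Proof. by case. Qed.

Lemma good_density_measurable f : good_density f -> measurable_fun setT f.
Proof. by case=> cf _ _ _ _; exact: continuous_measurable_fun. Qed.

Lemma good_density_bounded f : good_density f -> exists B, forall x, f x <= B.
Proof. by case=> _ [B fB] _ _ _; exists B => x; exact: le_trans (ler_norm _) (fB x). Qed.

Lemma good_density_translate f (a : R) : good_density f ->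
  (\int[@leb R]_x (f (x + a))%:E = 1)%E.
Proof.
case=> cf _ f0 _ f1; rewrite (@ge0_integral_translate R f) // => x.
exact: ltW.
Qed.

(** Symmetry of [f] turns the reflection into a translation by [- a]. *)
Lemma good_density_reflect f (a : R) : good_density f ->
  (\int[@leb R]_x (f (a - x))%:E = 1)%E.
Proof.
move=> gf; rewrite -(good_density_translate (- a) gf).
by apply: eq_integral => x _; rewrite -(good_densityN _ gf) opprB.
Qed.

Lemma integral_bounded_mul_le f g (B : R) :
  measurable_fun setT f -> measurable_fun setT g ->
  (forall x, 0 <= f x <= B) -> (forall x, 0 <= g x) ->
  (\int[@leb R]_x (g x)%:E = 1)%E ->
  (\int[@leb R]_x (f x * g x)%:E <= B%:E)%E.
Proof.
move=> mf mg fB g0 g1; have B0 : 0 <= B by case/andP: (fB 0); exact: le_trans.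
apply: (@le_trans _ _ (\int[@leb R]_x (B%:E * (g x)%:E))%E).
  apply: ge0_le_integral => //.
  - by move=> x _; rewrite lee_fin mulr_ge0 //; case/andP: (fB x).
  - by apply/measurable_EFinP; exact: measurable_funM.
  - by apply/measurable_EFinP; exact: measurable_funM.
  - by move=> x _; rewrite -EFinM lee_fin ler_wpM2r //; case/andP: (fB x).
rewrite ge0_integralZl_EFin ?g1 ?mule1 //.
- by move=> x _; rewrite lee_fin.
- exact/measurable_EFinP.
Qed.

Variables (f1 f2 : R -> R) (y B1 B2 : R).
Hypotheses (gf1 : good_density f1) (gf2 : good_density f2).
Hypotheses (fB1 : forall x, f1 x <= B1) (fB2 : forall x, f2 x <= B2).
Hypothesis proper : proper_posterior f1 f2 y.

Let m1 := good_density_measurable gf1.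
Let m2 := good_density_measurable gf2.
Let f10 x : 0 <= f1 x. Proof. by rewrite ltW // good_density_gt0. Qed.
Let f20 x : 0 <= f2 x. Proof. by rewrite ltW // good_density_gt0. Qed.
Let lb1 K := continuous_gt0_bounded_below K (good_density_continuous gf1)
  (fun x => good_density_gt0 x gf1).
Let lb2 K := continuous_gt0_bounded_below K (good_density_continuous gf2)
  (fun x => good_density_gt0 x gf2).

(** In either variable, [f1] is bounded by [B1] and the factor [f2] integrates to one. *)
Lemma centred_regular : regular (p_centred f1 f2 y) B1.
Proof.
rewrite /p_centred; split => //.
- by move=> u t; rewrite mulr_gt0 // good_density_gt0.
- apply: measurable_funM.
    by apply: (measurableT_comp m1); exact: measurable_funB.
  by apply: (measurableT_comp m2); exact: measurable_funB.
- move=> K; have [d d0 hd] := lb1 (`|y| + K); have [e e0 he] := lb2 (K + K).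
  exists (d * e) => [|u t uK tK]; first exact: mulr_gt0.
  rewrite ler_pM ?(ltW d0) ?(ltW e0) //.
    by apply: hd; rewrite (le_trans (ler_normB _ _)) // lerD2l.
  by apply: he; rewrite (le_trans (ler_normB _ _)) // lerD.
- move=> t; apply: integral_bounded_mul_le => //.
  + by apply: (measurableT_comp m1); exact: measurable_funB.
  + by apply: (measurableT_comp m2); exact: measurable_funB.
  + by move=> x; rewrite f10 fB1.
  + exact: good_density_translate.
- move=> u; apply: integral_bounded_mul_le => //.
  + by apply: (measurableT_comp m2); exact: measurable_funB.
  + by move=> x; rewrite f10 fB1.
  + exact: good_density_reflect.
Qed.

(* Substitution [x = u + t]. *)
Lemma noncentred_marginal t :
  (\int[@leb R]_u (p_noncentred f1 f2 y u t)%:E =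
   \int[@leb R]_x (p_centred f1 f2 y x t)%:E)%E.
Proof.
rewrite -(@ge0_integral_translate R (fun x => p_centred f1 f2 y x t) t).
- apply: eq_integral => u _; rewrite /p_noncentred /p_centred; congr EFin.
  by congr (f1 _ * f2 _); ring.
- move=> x; apply: continuousM.
    apply: (@continuous_comp _ _ _ (fun x => y - x) f1).
      by apply: continuousB; [exact: cvg_cst | exact: cvg_id].
    exact: good_density_continuous.
  apply: (@continuous_comp _ _ _ (fun x => x - t) f2).
    by apply: continuousB; [exact: cvg_id | exact: cvg_cst].
  exact: good_density_continuous.
- by move=> x; rewrite mulr_ge0.
Qed.

(** Integrals over [u] reduce to the centred case, with bound [B1]. Over [t] the roles change:
    [f2 u] is bounded by [B2] and [f1] integrates to one. *)
Lemma noncentred_regular : regular (p_noncentred f1 f2 y) (Num.max B1 B2).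
Proof.
split.
- by move=> u t; rewrite mulr_gt0 // good_density_gt0.
- apply: measurable_funM; last exact: measurableT_comp m2 measurable_fst.
  apply: (measurableT_comp m1); apply: measurable_funB => //.
  exact: measurable_funB.
- move=> K; have [d d0 hd] := lb1 (`|y| + K + K); have [e e0 he] := lb2 K.
  exists (d * e) => [|u t uK tK]; first exact: mulr_gt0.
  rewrite ler_pM ?(ltW d0) ?(ltW e0) ?he //.
  apply: hd; rewrite (le_trans (ler_normB _ _)) // lerD //.
  by rewrite (le_trans (ler_normB _ _)) // lerD2l.
- move=> t; rewrite noncentred_marginal.
  by rewrite (le_trans (regular_intU centred_regular t)) // lee_fin le_max lexx.
- move=> u; rewrite /p_noncentred.
  apply: (@le_trans _ _ B2%:E); last by rewrite lee_fin le_max lexx orbT.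
  under eq_integral do rewrite mulrC.
  apply: integral_bounded_mul_le => //.
  + apply: (measurableT_comp m1); apply: measurable_funB => //.
    exact: measurable_funB.
  + by move=> x; rewrite f20 fB2.
  + under eq_integral do rewrite addrAC.
    exact: good_density_reflect.
- by under eq_integral do rewrite noncentred_marginal.
Qed.

End good_density.

Theorem mainTheorem1 (R : realType) (f1 f2 : R -> R) :
  good_density f1 -> good_density f2 ->
  forall y : R, proper_posterior f1 f2 y ->
  (PTIP (p_centred f1 f2) -> uniformly_ergodic (p_centred f1 f2 y)) /\
  (PTIP (p_noncentred f1 f2) -> uniformly_ergodic (p_noncentred f1 f2 y)).
Proof.
move=> gf1 gf2 y proper.
have [[B1 fB1] [B2 fB2]] := (good_density_bounded gf1, good_density_bounded gf2).
split=> /(_ y)[k [k0 [c [c1 [T tail_le]]]]].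
- exact: regular_ergodic (centred_regular gf1 gf2 fB1 proper) k0 c1 tail_le.
- exact: regular_ergodic (noncentred_regular gf1 gf2 fB1 fB2 proper) k0 c1 tail_le.
Qed.
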